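(* Let $\ell\in(\frac12,1)$ be fixed, and let $R_m(\cdot)$, $\alpha_\ell(m)$ and $\Psi_\ell$ be as defined in the context. The function $\Psi_\ell(\cdot)$ has a unique minimizer $c^*_\ell\in[0,\infty)$, and as $m\to\infty$ we have $$R_m(\alpha_\ell(m))=\ell^m\,\Psi_\ell(c^*_\ell)+O(\ell^m/m),$$ $$\alpha_\ell(m)=1-\frac{c^*_\ell}{m}+O(1/m^{3/2}),$$ with asymptotic constants that depend on the fixed contraction factor $\ell$.
   Context: Let $\sigma=\sqrt\ell$ and $\ell_\alpha=1-\alpha+\alpha\ell$. For integers $m\ge1$ and $\alpha\in[0,1]$ define $$R_m(\alpha)=(1-\ell)\,\ell_\alpha^{\,m}+\frac{2\ell}{\pi}\int_0^\pi\frac{\big((1-\alpha)^2+2\alpha(1-\alpha)\sigma\cos\theta+\alpha^2\sigma^2\big)^m\sin^2\theta}{1-2\sigma\cos\theta+\sigma^2}\,d\theta,$$ which is strictly convex on $[0,1]$; $\alpha_\ell(m)$ denotes its unique minimizer over $[0,1]$. For $c\ge0$ define $$\Psi_\ell(c)=(1-\ell)\,e^{c(1-\ell)/\ell}+\frac{2\ell}{\pi}\int_0^\pi\frac{e^{2c(\cos\theta/\sigma-1)}\sin^2\theta}{1-2\sigma\cos\theta+\sigma^2}\,d\theta .$$ *)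

(* Defs.v *)
(* Stdlib world: the classical reals [R], with Coquelicot's Riemann integral. *)
From Stdlib Require Export Reals ClassicalEpsilon.
From Coquelicot Require Export Coquelicot.
Open Scope R_scope.

Definition sigma (l : R) : R := sqrt l.

Definition ell (l alpha : R) : R := 1 - alpha + alpha * l.

Definition Rm (l : R) (m : nat) (alpha : R) : R :=
  (1 - l) * ell l alpha ^ m
  + 2 * l / PI *
    RInt (fun theta =>
            ((1 - alpha) ^ 2
             + 2 * alpha * (1 - alpha) * sigma l * cos theta
             + alpha ^ 2 * sigma l ^ 2) ^ m * sin theta ^ 2
            / (1 - 2 * sigma l * cos theta + sigma l ^ 2)) 0 PI.

Definition Psi (l c : R) : R :=
  (1 - l) * exp (c * (1 - l) / l)
  + 2 * l / PI *
    RInt (fun theta =>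
            exp (2 * c * (cos theta / sigma l - 1)) * sin theta ^ 2
            / (1 - 2 * sigma l * cos theta + sigma l ^ 2)) 0 PI.

Definition is_minimizer_on (D : R -> Prop) (f : R -> R) (x : R) : Prop :=
  D x /\ forall y, D y -> f x <= f y.

Definition is_unique_minimizer_on (D : R -> Prop) (f : R -> R) : R -> Prop :=
  unique (is_minimizer_on D f).

(* The unique minimizer of [Rm l m] over [0,1]; it exists for [1/2 < l < 1] and
   [m >= 1] because [Rm l m] is continuous and strictly convex there.  When there
   is no unique minimizer (e.g. [m = 0]) the value is unspecified. *)
Definition alpha_opt (l : R) (m : nat) : R :=
  epsilon (inhabits 0)
    (is_unique_minimizer_on (fun alpha => 0 <= alpha <= 1) (Rm l m)).

Definition is_bigO (u v : nat -> R) : Prop :=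
  exists C : R, eventually (fun m => Rabs (u m) <= C * Rabs (v m)).

(* Main.v *)
Require Import Defs.
From Stdlib Require Import Lra Lia.

(** With [x = 1 - alpha] and [c = m x], the function [G_m c = R_m(1 - c/m) / l^m]
    is, up to a factor [m(m-1)/m^2], as strongly convex as its pointwise limit
    [Psi], and [|G_m - Psi| <= C/m] on compact sets, because
    [(1 + y/m + z/m^2)^m = e^y + O(1/m)].  Since [G_m] and [Psi] both dominate an
    increasing affine function and agree at [0], their minimizers stay in a fixed
    compact set.  Hence the minimal values differ by [O(1/m)], and quadratic growth
    of [Psi] at its minimizer puts the two minimizers at distance [O(1/sqrt m)],
    that is [O(1/m^(3/2))] in the variable [alpha]. *)

(** * Quantitative convergence of compound powers to the exponential *)

(** Multiplying [1 - x <= exp (- x)] by [exp x] gives [exp x - 1 - x <= x * (exp x - 1)]. The right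
    side is at most [x ^ 2 * exp x] for [x >= 0] and at most [x ^ 2] for [x < 0]. *)
Lemma exp_sub_one_sub_le (x : R) : Rabs (exp x - 1 - x) <= x ^ 2 * exp (Rabs x).
Proof.
  pose proof (exp_ineq1_le x) as H1.
  pose proof (exp_ineq1_le (- x)) as H2.
  assert (H3 : exp x - 1 <= x * exp x).
  { assert (E : exp x * exp (- x) = 1) by (rewrite <- exp_plus, Rplus_opp_r; apply exp_0).
    pose proof (exp_pos x). nra. }
  rewrite (Rabs_pos_eq (exp x - 1 - x)) by lra.
  destruct (Rle_dec 0 x) as [Hx|Hx].
  - rewrite (Rabs_pos_eq x) by lra. nra.
  - assert (1 <= exp (Rabs x)).
    { pose proof (exp_ineq1_le (Rabs x)). pose proof (Rabs_pos x). lra. }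
    nra.
Qed.

Lemma exp_pow (x : R) (n : nat) : exp x ^ n = exp (INR n * x).
Proof.
  induction n as [|n IH].
  - simpl. rewrite Rmult_0_l, exp_0. reflexivity.
  - rewrite S_INR. simpl pow. rewrite IH, <- exp_plus. f_equal. ring.
Qed.

(** Telescoping by induction. The sharp exponent of [q] is [n - 1]; since [1 <= q], the exponent [n]
    is a weaker bound that avoids subtraction on [nat]. *)
Lemma pow_sub_le (a b q : R) (n : nat) :
  0 <= a <= q -> 0 <= b <= q -> 1 <= q ->
  Rabs (a ^ n - b ^ n) <= INR n * Rabs (a - b) * q ^ n.
Proof.
  intros Ha Hb Hq. induction n as [|n IH].
  - simpl. rewrite Rminus_diag, Rabs_R0. lra.
  - rewrite S_INR. simpl pow.
    replace (a * a ^ n - b * b ^ n) with (a * (a ^ n - b ^ n) + (a - b) * b ^ n) by ring.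
    eapply Rle_trans; [apply Rabs_triang|]. rewrite !Rabs_mult.
    rewrite (Rabs_pos_eq a), (Rabs_pos_eq (b ^ n)) by (try apply pow_le; lra).
    assert (b ^ n <= q ^ n) by (apply pow_incr; lra).
    assert (1 <= q ^ n) by (apply pow_R1_Rle; lra).
    pose proof (Rabs_pos (a ^ n - b ^ n)). pose proof (Rabs_pos (a - b)).
    pose proof (pos_INR n).
    assert (a * Rabs (a ^ n - b ^ n) <= q * (INR n * Rabs (a - b) * q ^ n)).
    { apply Rmult_le_compat; lra. }
    assert (Rabs (a - b) * b ^ n <= Rabs (a - b) * (q * q ^ n)).
    { apply Rmult_le_compat_l; nra. }
    nra.
Qed.

(** Write [exp y] as the [n]-th power of [exp (y / n)]. The two bases differ by [O(1/n^2)] and are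
    at most [exp ((Y + Z) / n)], whose [n]-th power does not depend on [n]; passing to powers by
    [pow_sub_le] costs one factor [n]. *)
Lemma compound_exp_close (Y Z y z : R) (n : nat) :
  (1 <= n)%nat -> Rabs y <= Y -> Rabs z <= Z ->
  0 <= 1 + y / INR n + z / INR n ^ 2 ->
  Rabs ((1 + y / INR n + z / INR n ^ 2) ^ n - exp y)
    <= (Y ^ 2 * exp Y + Z) * exp (Y + Z) / INR n.
Proof.
  intros Hn Hy Hz Hpos.
  assert (Hn1 : 1 <= INR n) by (apply (le_INR 1); exact Hn).
  set (N := INR n) in *.
  assert (HY : 0 <= Y) by (pose proof (Rabs_pos y); lra).
  assert (HZ : 0 <= Z) by (pose proof (Rabs_pos z); lra).
  assert (Ey : exp y = exp (y / N) ^ n).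
  { rewrite exp_pow. fold N. f_equal. field. lra. }
  assert (EQ : exp (Y + Z) = exp ((Y + Z) / N) ^ n).
  { rewrite exp_pow. fold N. f_equal. field. lra. }
  assert (HiN : 0 < / N <= 1).
  { split; [apply Rinv_0_lt_compat; lra|]. rewrite <- Rinv_1. apply Rinv_le_contravar; lra. }
  assert (Hy' : - Y <= y <= Y) by (apply Rabs_le_between; exact Hy).
  assert (Hz' : - Z <= z <= Z) by (apply Rabs_le_between; exact Hz).
  rewrite Ey, EQ.
  assert (Hbase : Rabs (1 + y / N + z / N ^ 2 - exp (y / N)) <= (Y ^ 2 * exp Y + Z) / N ^ 2).
  { replace (1 + y / N + z / N ^ 2 - exp (y / N))
      with (- (exp (y / N) - 1 - y / N) + z / N ^ 2) by ring.
    eapply Rle_trans; [apply Rabs_triang|]. rewrite Rabs_Ropp.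
    pose proof (exp_sub_one_sub_le (y / N)) as H.
    assert (Hz2 : Rabs (z / N ^ 2) <= Z / N ^ 2).
    { unfold Rdiv. rewrite Rabs_mult, (Rabs_pos_eq (/ N ^ 2)).
      - apply Rmult_le_compat_r; [|exact Hz]. left; apply Rinv_0_lt_compat, pow_lt; lra.
      - left; apply Rinv_0_lt_compat, pow_lt; lra. }
    assert (Hyn : Rabs (y / N) <= Y).
    { unfold Rdiv. rewrite Rabs_mult, (Rabs_pos_eq (/ N)) by lra.
      pose proof (Rabs_pos y). nra. }
    assert (He : exp (Rabs (y / N)) <= exp Y).
    { destruct Hyn as [Hyn|Hyn]; [left; apply exp_increasing; exact Hyn|rewrite Hyn; lra]. }
    assert (Hs : (y / N) ^ 2 <= Y ^ 2 / N ^ 2).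
    { replace ((y / N) ^ 2) with (y ^ 2 / N ^ 2) by (field; lra).
      apply Rmult_le_compat_r; [left; apply Rinv_0_lt_compat, pow_lt; lra|nra]. }
    assert ((y / N) ^ 2 * exp (Rabs (y / N)) <= Y ^ 2 / N ^ 2 * exp Y).
    { apply Rmult_le_compat; [apply pow2_ge_0|left; apply exp_pos|exact Hs|exact He]. }
    replace ((Y ^ 2 * exp Y + Z) / N ^ 2) with (Y ^ 2 / N ^ 2 * exp Y + Z / N ^ 2)
      by (field; lra).
    lra. }
  eapply Rle_trans.
  - apply (pow_sub_le _ _ (exp ((Y + Z) / N))).
    + split; [exact Hpos|].
      apply Rle_trans with (1 + (Y + Z) / N); [|apply exp_ineq1_le].
      assert (z / N ^ 2 <= Z / N).
      { replace (z / N ^ 2) with (z * / N * / N) by (field; lra). unfold Rdiv.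
        apply Rmult_le_compat_r; [lra|]. nra. }
      assert (y / N <= Y / N) by (apply Rmult_le_compat_r; lra).
      unfold Rdiv in *. lra.
    + split; [left; apply exp_pos|].
      assert (H : y / N <= (Y + Z) / N) by (apply Rmult_le_compat_r; lra).
      destruct H as [H|H]; [left; apply exp_increasing; exact H|rewrite H; lra].
    + pose proof (exp_ineq1_le ((Y + Z) / N)).
      assert (0 <= (Y + Z) / N) by (apply Rmult_le_pos; lra). lra.
  - fold N.
    replace ((Y ^ 2 * exp Y + Z) * exp ((Y + Z) / N) ^ n / N)
      with (N * ((Y ^ 2 * exp Y + Z) / N ^ 2) * exp ((Y + Z) / N) ^ n) by (field; lra).
    apply Rmult_le_compat_r; [apply pow_le; left; apply exp_pos|].
    apply Rmult_le_compat_l; lra.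
Qed.

(** * Midpoint convexity of exponentials and powers *)

(** The convexity defect equals [(exp (y / 2) - exp (x / 2)) ^ 2 / 2], and on the nonnegative
    half-line the exponential expands distances. *)
Lemma exp_midpoint_strong (x y : R) : 0 <= x -> 0 <= y ->
  exp ((x + y) / 2) <= (exp x + exp y) / 2 - (x - y) ^ 2 / 8.
Proof.
  revert x y.
  assert (H : forall x y, 0 <= x <= y ->
    exp ((x + y) / 2) <= (exp x + exp y) / 2 - (x - y) ^ 2 / 8).
  { intros x y Hxy.
    replace ((x + y) / 2) with (x / 2 + y / 2) by field.
    replace (exp x) with (exp (x / 2) * exp (x / 2)) by (rewrite <- exp_plus; f_equal; field).
    replace (exp y) with (exp (y / 2) * exp (y / 2)) by (rewrite <- exp_plus; f_equal; field).
    rewrite exp_plus.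
    assert (E : exp (y / 2) = exp (x / 2) * exp ((y - x) / 2))
      by (rewrite <- exp_plus; f_equal; field).
    pose proof (exp_ineq1_le (x / 2)). pose proof (exp_ineq1_le ((y - x) / 2)).
    assert ((y - x) / 2 <= exp (y / 2) - exp (x / 2)) by nra.
    nra. }
  intros x y Hx Hy. destruct (Rle_dec x y) as [Hxy|Hxy].
  - apply H; lra.
  - rewrite (Rplus_comm x), (Rplus_comm (exp x)).
    replace ((x - y) ^ 2) with ((y - x) ^ 2) by ring. apply H; lra.
Qed.

Lemma exp_midpoint (x y : R) : exp ((x + y) / 2) <= (exp x + exp y) / 2.
Proof.
  replace ((x + y) / 2) with (x / 2 + y / 2) by field.
  replace (exp x) with (exp (x / 2) * exp (x / 2)) by (rewrite <- exp_plus; f_equal; field).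
  replace (exp y) with (exp (y / 2) * exp (y / 2)) by (rewrite <- exp_plus; f_equal; field).
  rewrite exp_plus. pose proof (pow2_ge_0 (exp (x / 2) - exp (y / 2))). nra.
Qed.

Lemma pow_midpoint_strong (x y : R) (n : nat) : 1 <= x -> 1 <= y ->
  ((x + y) / 2) ^ n <= (x ^ n + y ^ n) / 2 - INR n * (INR n - 1) * (x - y) ^ 2 / 8.
Proof.
  intros Hx Hy.
  (* The bound on the even part needs one on the odd part for the induction. *)
  assert (H : 2 * ((x + y) / 2) ^ n + INR n * (INR n - 1) * ((x - y) / 2) ^ 2 <= x ^ n + y ^ n
     /\ 2 * INR n * ((x - y) / 2) ^ 2 <= (x - y) / 2 * (x ^ n - y ^ n)); [|lra].
  induction n as [|n [IH1 IH2]]; [simpl; lra|].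
  rewrite S_INR. simpl pow.
  assert (1 <= x ^ n) by (apply pow_R1_Rle; lra).
  assert (1 <= y ^ n) by (apply pow_R1_Rle; lra).
  assert (0 <= ((x + y) / 2) ^ n) by (apply pow_le; lra).
  pose proof (pos_INR n) as HN.
  set (d := (x - y) / 2) in *. set (p := (x + y) / 2) in *.
  assert (1 <= p) by (unfold p; lra).
  set (u := x ^ n) in *. set (v := y ^ n) in *.
  pose proof (pow2_ge_0 d) as Hd.
  assert (HNd : 0 <= INR n * (INR n - 1) * d ^ 2).
  { destruct n; [simpl; lra|]. apply Rmult_le_pos; [|exact Hd].
    rewrite S_INR in *. pose proof (pos_INR n). nra. }
  assert (0 <= 2 * INR n * d ^ 2) by (apply Rmult_le_pos; nra).
  (* Since [x = p + d] and [y = p - d], the sum and the difference of the powers obey a coupled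
     linear recursion; [p >= 1] keeps the bounds already gained. *)
  assert (E1 : x * u + y * v = p * (u + v) + d * (u - v)) by (unfold p, d; field).
  assert (E2 : d * (x * u - y * v) = p * (d * (u - v)) + d ^ 2 * (u + v))
    by (unfold p, d; field).
  split.
  - rewrite E1.
    assert (p * (2 * p ^ n + INR n * (INR n - 1) * d ^ 2) <= p * (u + v))
      by (apply Rmult_le_compat_l; lra).
    assert (0 <= (p - 1) * (INR n * (INR n - 1) * d ^ 2)) by (apply Rmult_le_pos; lra).
    lra.
  - rewrite E2.
    assert (p * (2 * INR n * d ^ 2) <= p * (d * (u - v))) by (apply Rmult_le_compat_l; lra).
    assert (0 <= (p - 1) * (2 * INR n * d ^ 2)) by (apply Rmult_le_pos; lra).
    assert (d ^ 2 * 2 <= d ^ 2 * (u + v)) by (apply Rmult_le_compat_l; lra).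
    lra.
Qed.

Lemma pow_midpoint (x y : R) (n : nat) : 0 <= x -> 0 <= y ->
  ((x + y) / 2) ^ n <= (x ^ n + y ^ n) / 2.
Proof.
  intros Hx Hy. induction n as [|n IH]; [simpl; lra|].
  simpl pow.
  (* Bases and powers are ordered alike, so Chebyshev's sum inequality closes the induction. *)
  assert (0 <= (x - y) * (x ^ n - y ^ n)).
  { destruct (Rle_dec x y) as [H|H].
    - assert (x ^ n <= y ^ n) by (apply pow_incr; lra). nra.
    - assert (y ^ n <= x ^ n) by (apply pow_incr; lra). nra. }
  assert ((x + y) / 2 * ((x + y) / 2) ^ n <= (x + y) / 2 * ((x ^ n + y ^ n) / 2)).
  { apply Rmult_le_compat_l; lra. }
  lra.
Qed.

Lemma bernoulli (x : R) (n : nat) : 0 <= x -> 1 + INR n * x <= (1 + x) ^ n.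
Proof.
  intros Hx. induction n as [|n IH]; [simpl; lra|].
  rewrite S_INR. simpl pow. pose proof (pos_INR n). nra.
Qed.

(* The midpoint form passes through integrals without differentiating them. *)
Definition midpoint_strongly_convex_on (D : R -> Prop) (mu : R) (f : R -> R) : Prop :=
  forall x y, D x -> D y ->
    D ((x + y) / 2) /\ f ((x + y) / 2) <= (f x + f y) / 2 - mu * (x - y) ^ 2 / 8.

(** * Minimizers of strongly convex functions *)

(** Compare [f x] with the value at the midpoint of [x] and [y]. Using this one point gives the
    constant [1/4] instead of the sharp [1/2]. *)
Lemma strongly_convex_minimizer_growth (D : R -> Prop) (mu : R) (f : R -> R) (x y : R) :
  midpoint_strongly_convex_on D mu f -> is_minimizer_on D f x -> D y ->
  mu * (y - x) ^ 2 / 4 <= f y - f x.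
Proof.
  intros Hf [Dx Hx] Dy. destruct (Hf x y Dx Dy) as [Dm Hm].
  specialize (Hx _ Dm). nra.
Qed.

Lemma strongly_convex_minimizer_unique (D : R -> Prop) (mu : R) (f : R -> R) (x : R) :
  0 < mu -> midpoint_strongly_convex_on D mu f -> is_minimizer_on D f x ->
  is_unique_minimizer_on D f x.
Proof.
  intros Hmu Hf Hx. split; [exact Hx|]. intros y [Dy Hy].
  pose proof (strongly_convex_minimizer_growth D mu f x y Hf Hx Dy) as H.
  specialize (Hy x (proj1 Hx)).
  pose proof (pow2_ge_0 (y - x)).
  assert (E : (y - x) ^ 2 = 0) by nra.
  assert (y - x = 0) by (apply Rsqr_0_uniq; unfold Rsqr; lra). lra.
Qed.

(** * Continuity of integrals depending on a parameter *)

Lemma continuity_2d_pt_slice (f : R -> R -> R) (x t : R) :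
  continuity_2d_pt f x t -> continuous (f x) t.
Proof.
  intros Hf. apply continuity_pt_filterlim.
  intros eps Heps. destruct (Hf (mkposreal eps Heps)) as [d Hd].
  exists d. split; [apply cond_pos|]. intros u [_ Hu].
  apply Hd; [rewrite Rminus_diag, Rabs_R0; apply cond_pos|exact Hu].
Qed.

Lemma continuity_RInt_param (f : R -> R -> R) (a b x : R) : a <= b ->
  (forall u t, continuity_2d_pt f u t) -> continuity_pt (fun u => RInt (f u) a b) x.
Proof.
  intros Hab Hf eps Heps.
  (* The [+ 1] covers [a = b] and makes the final inequality strict. *)
  assert (He : 0 < eps / (b - a + 1)) by (apply Rdiv_lt_0_compat; lra).
  destruct (uniform_continuity_2d_1d' f a b x (fun t _ => Hf x t) (mkposreal _ He)) as [d Hd].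
  exists d. split; [apply cond_pos|]. intros u [_ Hu]. simpl in Hu. unfold R_dist in Hu.
  simpl. unfold R_dist.
  assert (Hex : forall v, ex_RInt (f v) a b).
  { intros v. apply (ex_RInt_continuous (V := R_CompleteNormedModule)).
    intros t _. apply continuity_2d_pt_slice, Hf. }
  replace (RInt (f u) a b - RInt (f x) a b) with (RInt (fun t => f u t - f x t) a b)
    by exact (RInt_minus (f u) (f x) a b (Hex u) (Hex x)).
  apply Rle_lt_trans with ((b - a) * (eps / (b - a + 1))).
  - apply abs_RInt_le_const; [exact Hab|apply (ex_RInt_minus (V := R_NormedModule)); apply Hex|].
    intros t Ht. left. apply Hd; try exact Ht.
    + pose proof (cond_pos d). lra.
    + apply Rabs_def2 in Hu. lra.
    + rewrite Rminus_diag, Rabs_R0. apply cond_pos.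
  - replace ((b - a) * (eps / (b - a + 1))) with (eps - eps / (b - a + 1)) by (field; lra).
    lra.
Qed.

Lemma ex_derive_continuity_pt (f : R -> R) (x : R) : ex_derive f x -> continuity_pt f x.
Proof.
  intros Hf. apply continuity_pt_filterlim.
  exact (ex_derive_continuous (K := R_AbsRing) (V := R_NormedModule) f x Hf).
Qed.

(** * The weighted integral over the angle *)

Lemma sigma_bounds (l : R) : 0 < l < 1 -> 0 < sigma l < 1 /\ sigma l ^ 2 = l.
Proof.
  intros Hl. unfold sigma. pose proof (sqrt_sqrt l) as H.
  assert (0 < sqrt l) by (apply sqrt_lt_R0; lra).
  assert (sqrt l < 1) by (rewrite <- sqrt_1; apply sqrt_lt_1; lra).
  split; [lra|]. rewrite <- Rsqr_pow2. apply Rsqr_sqrt; lra.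
Qed.

(** The denominator is [|1 - sigma e^{it}|^2], at least [(1 - sigma)^2]. *)
Lemma den_pos (l t : R) : 0 < l < 1 -> 0 < 1 - 2 * sigma l * cos t + sigma l ^ 2.
Proof.
  intros Hl. destruct (sigma_bounds l Hl) as [Hs _].
  pose proof (COS_bound t). nra.
Qed.

Definition weight (l t : R) : R := sin t ^ 2 / (1 - 2 * sigma l * cos t + sigma l ^ 2).

(** Integration against [l] times the Marchenko-Pastur law of ratio [l], in the angle [t] with
    spectral variable [1 - 2 sigma cos t + sigma^2]. As a positive linear functional it transfers
    pointwise bounds on integrands to [Rm] and [Psi]. *)
Definition wint (l : R) (phi : R -> R) : R :=
  2 * l / PI * RInt (fun t => phi t * weight l t) 0 PI.

Lemma weight_nonneg (l t : R) : 0 < l < 1 -> 0 <= weight l t.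
Proof.
  intros Hl. apply Rmult_le_pos; [apply pow2_ge_0|].
  left. apply Rinv_0_lt_compat, den_pos, Hl.
Qed.

Lemma weight_continuous (l t : R) : 0 < l < 1 -> continuous (weight l) t.
Proof.
  intros Hl. pose proof (den_pos l t Hl) as Hd.
  apply (ex_derive_continuous (K := R_AbsRing) (V := R_NormedModule)).
  unfold weight. auto_derive. lra.
Qed.

Lemma wint_factor_pos (l : R) : 0 < l < 1 -> 0 < 2 * l / PI.
Proof. intros Hl. pose proof PI_RGT_0. apply Rdiv_lt_0_compat; lra. Qed.

Lemma ex_RInt_weighted (l : R) (phi : R -> R) : 0 < l < 1 -> (forall t, continuous phi t) ->
  ex_RInt (fun t => phi t * weight l t) 0 PI.
Proof.
  intros Hl Hphi. apply (ex_RInt_continuous (V := R_CompleteNormedModule)).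
  intros t _. apply (continuous_mult (K := R_AbsRing)); [apply Hphi|apply weight_continuous, Hl].
Qed.

Lemma wint_linear (l a b : R) (phi psi : R -> R) : 0 < l < 1 ->
  (forall t, continuous phi t) -> (forall t, continuous psi t) ->
  wint l (fun t => a * phi t + b * psi t) = a * wint l phi + b * wint l psi.
Proof.
  intros Hl Hphi Hpsi. unfold wint.
  pose proof (ex_RInt_weighted l phi Hl Hphi) as E1.
  pose proof (ex_RInt_weighted l psi Hl Hpsi) as E2.
  assert (E : RInt (fun t => (a * phi t + b * psi t) * weight l t) 0 PI
    = a * RInt (fun t => phi t * weight l t) 0 PI + b * RInt (fun t => psi t * weight l t) 0 PI).
  { apply is_RInt_unique.
    apply is_RInt_ext with
      (fun t => plus (scal a (phi t * weight l t)) (scal b (psi t * weight l t))).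
    - intros t _. unfold plus, scal; simpl. unfold mult; simpl. ring.
    - apply (is_RInt_plus (V := R_NormedModule)); apply (is_RInt_scal (V := R_NormedModule));
        apply (RInt_correct (V := R_CompleteNormedModule)); assumption. }
  rewrite E. ring.
Qed.

Lemma wint_le (l : R) (phi psi : R -> R) : 0 < l < 1 ->
  (forall t, continuous phi t) -> (forall t, continuous psi t) ->
  (forall t, phi t <= psi t) -> wint l phi <= wint l psi.
Proof.
  intros Hl Hphi Hpsi H. pose proof PI_RGT_0. pose proof (wint_factor_pos l Hl).
  apply Rmult_le_compat_l; [lra|].
  apply RInt_le; [lra|apply ex_RInt_weighted; assumption..|].
  intros t _. apply Rmult_le_compat_r; [apply weight_nonneg, Hl|apply H].
Qed.

Lemma wint_ext (l : R) (phi psi : R -> R) : (forall t, phi t = psi t) -> wint l phi = wint l psi.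
Proof.
  intros H. unfold wint. f_equal. apply RInt_ext. intros t _. rewrite H. reflexivity.
Qed.

Lemma wint_nonneg (l : R) (phi : R -> R) : 0 < l < 1 ->
  (forall t, continuous phi t) -> (forall t, 0 <= phi t) -> 0 <= wint l phi.
Proof.
  intros Hl Hphi H. pose proof PI_RGT_0. pose proof (wint_factor_pos l Hl).
  apply Rmult_le_pos; [lra|].
  apply RInt_ge_0; [lra|apply ex_RInt_weighted; assumption|].
  intros t _. apply Rmult_le_pos; [apply H|apply weight_nonneg, Hl].
Qed.

(** Monotonicity is applied to [phi <= d + psi] and to [psi <= d + phi]. The sums are spelled
    [d * 1 + 1 * chi t] to match [wint_linear]. *)
Lemma wint_close (l d : R) (phi psi : R -> R) : 0 < l < 1 ->
  (forall t, continuous phi t) -> (forall t, continuous psi t) ->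
  (forall t, Rabs (phi t - psi t) <= d) ->
  Rabs (wint l phi - wint l psi) <= d * wint l (fun _ => 1).
Proof.
  intros Hl Hphi Hpsi H.
  assert (H1 : forall t : R, continuous (fun _ : R => 1) t) by (intros; apply continuous_const).
  assert (HC : forall (chi : R -> R), (forall t, continuous chi t) ->
    forall t, continuous (fun t => d * 1 + 1 * chi t) t).
  { intros chi Hchi t. apply (continuous_plus (V := R_NormedModule)); [apply continuous_const|].
    apply (continuous_mult (K := R_AbsRing)); [apply continuous_const|apply Hchi]. }
  apply Rabs_le_between'. split.
  - assert (wint l psi <= wint l (fun t => d * 1 + 1 * phi t)).
    { apply wint_le; auto. intros t. specialize (H t). apply Rabs_le_between in H. lra. }
    rewrite wint_linear in * by auto. lra.
  - assert (wint l phi <= wint l (fun t => d * 1 + 1 * psi t)).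
    { apply wint_le; auto. intros t. specialize (H t). apply Rabs_le_between in H. lra. }
    rewrite wint_linear in * by auto. lra.
Qed.

Lemma wint_midpoint (l : R) (f : R -> R -> R) (x y : R) : 0 < l < 1 ->
  (forall u t, continuity_2d_pt f u t) ->
  (forall t, f ((x + y) / 2) t <= (f x t + f y t) / 2) ->
  wint l (f ((x + y) / 2)) <= (wint l (f x) + wint l (f y)) / 2.
Proof.
  intros Hl Hf H.
  assert (Hc : forall u t, continuous (f u) t) by (intros; apply continuity_2d_pt_slice, Hf).
  apply Rle_trans with (wint l (fun t => / 2 * f x t + / 2 * f y t)).
  - apply wint_le; auto.
    + intros t. apply (continuous_plus (V := R_NormedModule));
        (apply (continuous_mult (K := R_AbsRing)); [apply continuous_const|apply Hc]).
    + intros t. specialize (H t). lra.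
  - rewrite wint_linear by auto. lra.
Qed.

Lemma continuity_2d_pt_snd (g : R -> R) (u t : R) :
  continuity_pt g t -> continuity_2d_pt (fun _ v => g v) u t.
Proof.
  intros Hg. apply (continuity_1d_2d_pt_comp g (fun _ v => v)); [exact Hg|].
  apply continuity_2d_pt_id2.
Qed.

Lemma wint_continuity (l : R) (f : R -> R -> R) (x : R) : 0 < l < 1 ->
  (forall u t, continuity_2d_pt f u t) -> continuity_pt (fun u => wint l (f u)) x.
Proof.
  intros Hl Hf. pose proof PI_RGT_0. unfold wint.
  apply continuity_pt_mult; [apply continuity_pt_const; intros ? ?; reflexivity|].
  apply (continuity_RInt_param (fun u t => f u t * weight l t)); [lra|].
  intros u t. apply continuity_2d_pt_mult; [apply Hf|].
  apply continuity_2d_pt_snd, continuity_pt_filterlim, weight_continuous, Hl.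
Qed.

(** * [Rm] and [Psi] as weighted integrals *)

(** At [alpha = 1 - x], the bracket in [Rm] divided by [l] is the quadratic [base] in [x], with
    coefficients [1], [tilt], [curv], and [ell] divided by [l] is [1 + x * rate l]. The first-order
    coefficients [tilt] and [rate] are the exponents in [Psi]. *)
Definition tilt (l t : R) : R := 2 * (cos t / sigma l - 1).

Definition curv (l t : R) : R := 1 - 2 * cos t / sigma l + 1 / l.

Definition base (l x t : R) : R := 1 + x * tilt l t + x ^ 2 * curv l t.

Definition rate (l : R) : R := (1 - l) / l.

(* [R_m(1 - x) / l^m]; see [Rm_Fm]. *)
Definition Fm (l : R) (m : nat) (x : R) : R :=
  (1 - l) * (1 + x * rate l) ^ m + wint l (fun t => base l x t ^ m).

Lemma base_nonneg (l x t : R) : 0 < l < 1 -> 0 <= base l x t.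
Proof.
  (* [base l x t] is [|1 - x + x e^{it} / sigma|^2]. *)
  intros Hl. destruct (sigma_bounds l Hl) as [Hs Es].
  replace (base l x t) with ((1 - x + x * cos t / sigma l) ^ 2 + (x * sin t / sigma l) ^ 2).
  - pose proof (pow2_ge_0 (1 - x + x * cos t / sigma l)).
    pose proof (pow2_ge_0 (x * sin t / sigma l)). lra.
  - unfold base, tilt, curv. pose proof (sin2_cos2 t) as E. unfold Rsqr in E.
    replace (1 / l) with ((sin t * sin t + cos t * cos t) / sigma l ^ 2) by (rewrite E, Es; reflexivity).
    field. lra.
Qed.

Lemma base_continuity (l u t : R) : continuity_2d_pt (base l) u t.
Proof.
  assert (Hc : forall a : R, continuity_2d_pt (fun _ v => cos v / a) u t).
  { intros a. apply continuity_2d_pt_mult; [|apply continuity_2d_pt_const].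
    apply continuity_2d_pt_snd, continuity_cos. }
  assert (Ht : continuity_2d_pt (fun _ v => tilt l v) u t).
  { apply continuity_2d_pt_mult; [apply continuity_2d_pt_const|].
    apply continuity_2d_pt_minus; [apply Hc|apply continuity_2d_pt_const]. }
  unfold base. repeat apply continuity_2d_pt_plus.
  - apply continuity_2d_pt_const.
  - apply continuity_2d_pt_mult; [apply continuity_2d_pt_id1|exact Ht].
  - apply continuity_2d_pt_mult.
    + simpl. repeat apply continuity_2d_pt_mult;
        try apply continuity_2d_pt_id1; apply continuity_2d_pt_const.
    + apply continuity_2d_pt_ext with (fun _ v => 1 - 2 * (cos v / sigma l) + 1 / l).
      { intros _ v. unfold curv. unfold Rdiv. ring. }
      apply continuity_2d_pt_plus; [|apply continuity_2d_pt_const].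
      apply continuity_2d_pt_minus; [apply continuity_2d_pt_const|].
      apply continuity_2d_pt_mult; [apply continuity_2d_pt_const|apply Hc].
Qed.

Lemma base_pow_continuity (l : R) (m : nat) (u t : R) :
  continuity_2d_pt (fun x v => base l x v ^ m) u t.
Proof.
  apply (continuity_1d_2d_pt_comp (fun x => x ^ m)).
  - apply derivable_continuous_pt, derivable_pt_pow.
  - apply base_continuity.
Qed.

Lemma exp_tilt_continuity (l u t : R) : continuity_2d_pt (fun c v => exp (c * tilt l v)) u t.
Proof.
  apply (continuity_1d_2d_pt_comp exp).
  - apply derivable_continuous_pt, derivable_pt_exp.
  - apply continuity_2d_pt_mult; [apply continuity_2d_pt_id1|].
    apply (continuity_2d_pt_snd (tilt l)). apply ex_derive_continuity_pt.
    unfold tilt. auto_derive. exact I.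
Qed.

Lemma Rm_Fm (l : R) (m : nat) (x : R) : 0 < l < 1 -> Rm l m (1 - x) = l ^ m * Fm l m x.
Proof.
  intros Hl. destruct (sigma_bounds l Hl) as [Hs Es]. unfold Rm, Fm.
  replace (ell l (1 - x)) with (l * (1 + x * rate l))
    by (unfold ell, rate; field; lra).
  rewrite Rpow_mult_distr.
  replace (l ^ m * wint l (fun t => base l x t ^ m))
    with (l ^ m * wint l (fun t => base l x t ^ m) + 0 * wint l (fun t => base l x t ^ m)) by ring.
  rewrite Rmult_plus_distr_l. f_equal; [ring|].
  assert (Hc : forall t, continuous (fun t => base l x t ^ m) t).
  { intros t. apply (continuity_2d_pt_slice (fun x t => base l x t ^ m)), base_pow_continuity. }
  (* The null second term lets [wint_linear] pull out the factor [l ^ m]. *)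
  transitivity (wint l (fun t => l ^ m * base l x t ^ m + 0 * base l x t ^ m)).
  - unfold wint. f_equal. apply RInt_ext. intros t _. unfold weight.
    rewrite Rmult_0_l, Rplus_0_r, <- (Rpow_mult_distr l (base l x t)). unfold Rdiv. rewrite Rmult_assoc. do 2 f_equal.
    (* With [l] replaced by [s ^ 2], the identity is rational in [s], [x] and [cos t]. *)
    unfold base, tilt, curv. clear Hc. generalize dependent (sigma l). intros s Hs Es.
    rewrite <- Es. field. lra.
  - rewrite wint_linear by assumption. ring.
Qed.

Lemma Psi_wint (l c : R) :
  Psi l c = (1 - l) * exp (c * rate l) + wint l (fun t => exp (c * tilt l t)).
Proof.
  unfold Psi, wint. f_equal.
  - unfold rate, Rdiv. rewrite Rmult_assoc. reflexivity.
  - f_equal. apply RInt_ext. intros t _. unfold weight, tilt, Rdiv.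
    rewrite Rmult_assoc. do 2 f_equal. ring.
Qed.

(** * Strong convexity and continuity of [Psi] and [Rm] *)

Lemma rate_pos (l : R) : 0 < l < 1 -> 0 < rate l.
Proof. intros Hl. apply Rdiv_lt_0_compat; lra. Qed.

(** The modulus comes from the first term alone, whose exponent is nonnegative for [c >= 0]. The
    integral contributes plain convexity, as [tilt] may be negative. *)
Lemma Psi_strongly_convex (l : R) : 0 < l < 1 ->
  midpoint_strongly_convex_on (fun x => 0 <= x) ((1 - l) * rate l ^ 2) (Psi l).
Proof.
  intros Hl x y Hx Hy. split; [lra|]. pose proof (rate_pos l Hl) as Hk.
  rewrite !Psi_wint.
  pose proof (exp_midpoint_strong (x * rate l) (y * rate l)) as H1.
  replace ((x + y) / 2 * rate l) with ((x * rate l + y * rate l) / 2) by field.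
  assert (H2 := wint_midpoint l (fun c t => exp (c * tilt l t)) x y Hl (exp_tilt_continuity l)).
  simpl in H2.
  assert (H3 : forall t, exp ((x + y) / 2 * tilt l t) <= (exp (x * tilt l t) + exp (y * tilt l t)) / 2).
  { intros t. replace ((x + y) / 2 * tilt l t) with ((x * tilt l t + y * tilt l t) / 2) by field.
    apply exp_midpoint. }
  specialize (H2 H3).
  assert (H4 := Rmult_le_compat_l (1 - l) _ _ ltac:(lra)
    (H1 ltac:(apply Rmult_le_pos; lra) ltac:(apply Rmult_le_pos; lra))).
  replace ((x * rate l - y * rate l) ^ 2) with (rate l ^ 2 * (x - y) ^ 2) in H4 by ring.
  lra.
Qed.

(** Again the modulus comes from the first term, where [1 + x * rate l >= 1]. The integrand is
    convex in [x], being a power of a nonnegative convex quadratic. *)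
Lemma Rm_strongly_convex (l : R) (m : nat) : 0 < l < 1 ->
  midpoint_strongly_convex_on (fun x => 0 <= x <= 1)
    (l ^ m * ((1 - l) * rate l ^ 2 * (INR m * (INR m - 1)))) (Rm l m).
Proof.
  intros Hl a b Ha Hb. split; [lra|]. pose proof (rate_pos l Hl) as Hk.
  replace ((a + b) / 2) with (1 - ((1 - a) + (1 - b)) / 2) by field.
  replace (Rm l m a) with (Rm l m (1 - (1 - a))) by (f_equal; ring).
  replace (Rm l m b) with (Rm l m (1 - (1 - b))) by (f_equal; ring).
  replace (a - b) with ((1 - b) - (1 - a)) by ring.
  assert (Hx : 0 <= 1 - a) by lra. assert (Hy : 0 <= 1 - b) by lra.
  generalize dependent (1 - b). intros y Hy. generalize dependent (1 - a). intros x Hx.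
  rewrite !Rm_Fm by exact Hl.
  enough (Fm l m ((x + y) / 2) <= (Fm l m x + Fm l m y) / 2
    - (1 - l) * rate l ^ 2 * (INR m * (INR m - 1)) * (y - x) ^ 2 / 8) as H.
  { apply (Rmult_le_compat_l (l ^ m)) in H; [lra|apply pow_le; lra]. }
  unfold Fm.
  assert (H1 := pow_midpoint_strong (1 + x * rate l) (1 + y * rate l) m).
  replace (1 + (x + y) / 2 * rate l) with ((1 + x * rate l + (1 + y * rate l)) / 2) by field.
  assert (H2 := wint_midpoint l (fun x t => base l x t ^ m) x y Hl (base_pow_continuity l m)).
  simpl in H2.
  assert (H3 : forall t, base l ((x + y) / 2) t ^ m <= (base l x t ^ m + base l y t ^ m) / 2).
  { intros t. destruct (sigma_bounds l Hl) as [Hs Es].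
    apply Rle_trans with (((base l x t + base l y t) / 2) ^ m).
    - apply pow_incr. split; [apply base_nonneg, Hl|].
      (* [curv] is the positive denominator of [weight] divided by [l], so the parabola [base] opens
         upwards. *)
      assert (0 <= curv l t).
      { unfold curv.
        replace (1 - 2 * cos t / sigma l + 1 / l)
          with ((1 - 2 * sigma l * cos t + sigma l ^ 2) / l).
        - left. apply Rdiv_lt_0_compat; [apply den_pos, Hl|lra].
        - clear - Hs Es. generalize dependent (sigma l). intros s Hs Es.
          rewrite <- Es. field. lra. }
      pose proof (pow2_ge_0 (x - y)). unfold base. nra.
    - apply pow_midpoint; apply base_nonneg, Hl. }
  specialize (H2 H3).
  assert (0 <= x * rate l) by (apply Rmult_le_pos; lra).
  assert (0 <= y * rate l) by (apply Rmult_le_pos; lra).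
  assert (H4 := Rmult_le_compat_l (1 - l) _ _ ltac:(lra) (H1 ltac:(lra) ltac:(lra))).
  replace ((1 + x * rate l - (1 + y * rate l)) ^ 2) with (rate l ^ 2 * (y - x) ^ 2) in H4 by ring.
  lra.
Qed.

Lemma Psi_continuity (l c : R) : 0 < l < 1 -> continuity_pt (Psi l) c.
Proof.
  intros Hl.
  apply (continuity_pt_ext
    (fun c => (1 - l) * exp (c * rate l) + wint l (fun t => exp (c * tilt l t)))).
  { intros x. symmetry. apply Psi_wint. }
  apply continuity_pt_plus; [|apply wint_continuity; [exact Hl|apply exp_tilt_continuity]].
  apply ex_derive_continuity_pt. auto_derive. exact I.
Qed.

Lemma Rm_continuity (l : R) (m : nat) (a : R) : 0 < l < 1 -> continuity_pt (Rm l m) a.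
Proof.
  intros Hl.
  apply (continuity_pt_ext (fun a => l ^ m * Fm l m (1 - a))).
  { intros x. rewrite <- Rm_Fm by exact Hl. f_equal. ring. }
  apply continuity_pt_mult; [apply continuity_pt_const; intros ? ?; reflexivity|].
  unfold Fm. apply continuity_pt_plus.
  - apply ex_derive_continuity_pt. auto_derive. exact I.
  - apply (continuity_pt_comp (fun a => 1 - a) (fun x => wint l (fun t => base l x t ^ m))).
    + apply ex_derive_continuity_pt. auto_derive. exact I.
    + apply (wint_continuity l (fun x t => base l x t ^ m)); [exact Hl|apply base_pow_continuity].
Qed.

(** * Coercivity, and convergence of [Fm] to [Psi] on compact sets *)

Lemma Psi_lower (l c : R) : 0 < l < 1 -> (1 - l) * (1 + c * rate l) <= Psi l c.
Proof.
  intros Hl. rewrite Psi_wint.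
  assert (0 <= wint l (fun t => exp (c * tilt l t))).
  { apply wint_nonneg; [exact Hl| |intros t; left; apply exp_pos].
    intros t. apply (continuity_2d_pt_slice (fun c t => exp (c * tilt l t))), exp_tilt_continuity. }
  pose proof (exp_ineq1_le (c * rate l)).
  assert ((1 - l) * (1 + c * rate l) <= (1 - l) * exp (c * rate l))
    by (apply Rmult_le_compat_l; lra).
  lra.
Qed.

(** In the variable [c = m x] this is the affine bound of [Psi_lower], hence uniform in [m]. With
    [Fm_0] it confines the rescaled minimizers to one compact interval. *)
Lemma Fm_lower (l : R) (m : nat) (x : R) : 0 < l < 1 -> 0 <= x ->
  (1 - l) * (1 + INR m * x * rate l) <= Fm l m x.
Proof.
  intros Hl Hx. unfold Fm. pose proof (rate_pos l Hl).
  assert (0 <= wint l (fun t => base l x t ^ m)).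
  { apply wint_nonneg; [exact Hl| |intros t; apply pow_le, base_nonneg, Hl].
    intros t. apply (continuity_2d_pt_slice (fun x t => base l x t ^ m)), base_pow_continuity. }
  assert (H1 := bernoulli (x * rate l) m ltac:(apply Rmult_le_pos; lra)).
  assert ((1 - l) * (1 + INR m * x * rate l) <= (1 - l) * (1 + x * rate l) ^ m)
    by (apply Rmult_le_compat_l; lra).
  lra.
Qed.

Lemma Fm_0 (l : R) (m : nat) : Fm l m 0 = Psi l 0.
Proof.
  rewrite Psi_wint. unfold Fm. f_equal.
  - rewrite !Rmult_0_l, Rplus_0_r, pow1, exp_0. reflexivity.
  - apply wint_ext. intros t. rewrite Rmult_0_l, exp_0.
    replace (base l 0 t) with 1 by (unfold base; ring). apply pow1.
Qed.

Lemma Fm_close_Psi (l K : R) : 0 < l < 1 -> 0 <= K ->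
  exists C, 0 <= C /\ forall (m : nat) (c : R), (1 <= m)%nat -> 0 <= c <= K ->
    Rabs (Fm l m (c / INR m) - Psi l c) <= C / INR m.
Proof.
  intros Hl HK. destruct (sigma_bounds l Hl) as [Hs Es]. pose proof (rate_pos l Hl) as Hk.
  set (s := sigma l) in *.
  (* [Y] and [Z] bound [c * tilt l t] and [c ^ 2 * curv l t] in absolute value for [0 <= c <= K],
     uniformly in [t], because [|cos t| <= 1]; [B] is the constant of [compound_exp_close]. *)
  set (Y := K * (2 * (/ s + 1))). set (Z := K ^ 2 * (1 + 2 / s + 1 / l)).
  set (B := fun Y Z => (Y ^ 2 * exp Y + Z) * exp (Y + Z)).
  assert (Hi : 0 < / s) by (apply Rinv_0_lt_compat; lra).
  assert (Hil : 0 < / l) by (apply Rinv_0_lt_compat; lra).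
  assert (HB : forall Y Z, 0 <= Z -> 0 <= B Y Z).
  { intros Y' Z' HZ'. apply Rmult_le_pos; [|left; apply exp_pos].
    apply Rplus_le_le_0_compat; [|exact HZ'].
    apply Rmult_le_pos; [apply pow2_ge_0|left; apply exp_pos]. }
  assert (HZ : 0 <= Z).
  { unfold Z, Rdiv. apply Rmult_le_pos; [apply pow2_ge_0|lra]. }
  assert (H1c : forall t : R, continuous (fun _ : R => 1) t) by (intros; apply continuous_const).
  assert (HW : 0 <= wint l (fun _ => 1)) by (apply wint_nonneg; auto; intros; lra).
  exists ((1 - l) * B (K * rate l) 0 + B Y Z * wint l (fun _ => 1)).
  split.
  { apply Rplus_le_le_0_compat; apply Rmult_le_pos; try apply HB; lra. }
  intros m c Hm Hc.
  assert (Hm1 : 1 <= INR m) by (apply (le_INR 1); exact Hm).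
  assert (T1 : Rabs ((1 + c / INR m * rate l) ^ m - exp (c * rate l)) <= B (K * rate l) 0 / INR m).
  { assert (0 <= c * rate l) by (apply Rmult_le_pos; lra).
    assert (E : 1 + c / INR m * rate l = 1 + c * rate l / INR m + 0 / INR m ^ 2) by (field; lra).
    rewrite E. apply compound_exp_close; [exact Hm| | |].
    - rewrite Rabs_pos_eq by lra. apply Rmult_le_compat_r; lra.
    - rewrite Rabs_R0. lra.
    - rewrite <- E. assert (0 <= c / INR m) by (apply Rdiv_le_0_compat; lra). nra. }
  assert (T2 : forall t, Rabs (base l (c / INR m) t ^ m - exp (c * tilt l t)) <= B Y Z / INR m).
  { intros t.
    assert (E : base l (c / INR m) t = 1 + c * tilt l t / INR m + c ^ 2 * curv l t / INR m ^ 2)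
      by (unfold base; field; lra).
    pose proof (COS_bound t) as Hcos.
    assert (Hq : - / s <= cos t / s <= / s) by (unfold Rdiv; split; nra).
    assert (Hp := base_nonneg l (c / INR m) t Hl).
    rewrite E in *. apply compound_exp_close; [exact Hm| | |exact Hp].
    - rewrite Rabs_mult, (Rabs_pos_eq c) by lra.
      apply Rmult_le_compat; [lra|apply Rabs_pos|lra|].
      unfold tilt; fold s. apply Rabs_le_between. lra.
    - rewrite Rabs_mult, (Rabs_pos_eq (c ^ 2)) by apply pow2_ge_0.
      apply Rmult_le_compat; [apply pow2_ge_0|apply Rabs_pos|apply pow_incr; lra|].
      unfold curv; fold s. unfold Rdiv in *. apply Rabs_le_between. lra. }
  rewrite Psi_wint. unfold Fm.
  assert (T3 := wint_close l (B Y Z / INR m) _ _ Hl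
    (fun t => continuity_2d_pt_slice _ _ _ (base_pow_continuity l m (c / INR m) t))
    (fun t => continuity_2d_pt_slice _ _ _ (exp_tilt_continuity l c t)) T2).
  simpl in T3.
  replace ((1 - l) * (1 + c / INR m * rate l) ^ m + wint l (fun t => base l (c / INR m) t ^ m)
    - ((1 - l) * exp (c * rate l) + wint l (fun t => exp (c * tilt l t))))
    with ((1 - l) * ((1 + c / INR m * rate l) ^ m - exp (c * rate l))
      + (wint l (fun t => base l (c / INR m) t ^ m) - wint l (fun t => exp (c * tilt l t)))) by ring.
  eapply Rle_trans; [apply Rabs_triang|].
  rewrite Rabs_mult, (Rabs_pos_eq (1 - l)) by lra.
  apply (Rmult_le_compat_l (1 - l)) in T1; [|lra].
  unfold Rdiv in *. lra.
Qed.

(** * Existence and uniqueness of the minimizers *)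

Lemma Psi_unique_minimizer (l : R) : 0 < l < 1 ->
  exists c, is_unique_minimizer_on (fun x => 0 <= x) (Psi l) c.
Proof.
  intros Hl. pose proof (rate_pos l Hl) as Hk.
  assert (Hm : 0 < (1 - l) * rate l) by (apply Rmult_lt_0_compat; lra).
  (* Beyond this [K] the bound of [Psi_lower] exceeds [Psi l 0], so minimizing over [[0, K]]
     suffices. *)
  set (K := Psi l 0 / ((1 - l) * rate l)).
  assert (HK : K * ((1 - l) * rate l) = Psi l 0) by (unfold K; field; lra).
  assert (HK0 : 0 <= K).
  { apply Rdiv_le_0_compat; [|exact Hm]. pose proof (Psi_lower l 0 Hl). lra. }
  destruct (continuity_ab_min (Psi l) 0 K HK0 (fun c _ => Psi_continuity l c Hl)) as [c [Hc Ic]].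
  exists c. apply strongly_convex_minimizer_unique with (mu := (1 - l) * rate l ^ 2).
  - apply Rmult_lt_0_compat; [lra|apply pow_lt; exact Hk].
  - apply Psi_strongly_convex, Hl.
  - split; [lra|]. intros y Hy. destruct (Rle_dec y K) as [H|H]; [apply Hc; lra|].
    apply Rle_trans with (Psi l 0); [apply Hc; lra|].
    pose proof (Psi_lower l y Hl). nra.
Qed.

(** For [m >= 2] the factor [m (m - 1)] in the modulus is positive, so a unique minimizer exists and
    [epsilon] selects it. *)
Lemma alpha_opt_minimizer (l : R) (m : nat) : 0 < l < 1 -> (2 <= m)%nat ->
  is_minimizer_on (fun a => 0 <= a <= 1) (Rm l m) (alpha_opt l m).
Proof.
  intros Hl Hm. pose proof (rate_pos l Hl) as Hk.
  assert (Hm2 : 2 <= INR m) by (apply (le_INR 2); exact Hm).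
  destruct (continuity_ab_min (Rm l m) 0 1 Rle_0_1 (fun a _ => Rm_continuity l m a Hl))
    as [a [Ha Ia]].
  enough (H : is_unique_minimizer_on (fun a => 0 <= a <= 1) (Rm l m) (alpha_opt l m))
    by exact (proj1 H).
  unfold alpha_opt. apply epsilon_spec. exists a.
  eapply strongly_convex_minimizer_unique; [|apply Rm_strongly_convex, Hl|].
  - apply Rmult_lt_0_compat; [apply pow_lt; lra|].
    apply Rmult_lt_0_compat; [|apply Rmult_lt_0_compat; lra].
    apply Rmult_lt_0_compat; [lra|apply pow_lt; exact Hk].
  - split; assumption.
Qed.

(** * Asymptotics of the minimum and of the minimizer *)

Theorem proposition11 (l : R) (Hl : 1 / 2 < l < 1) :
  exists c : R,
    is_unique_minimizer_on (fun x => 0 <= x) (Psi l) c /\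
    is_bigO (fun m => Rm l m (alpha_opt l m) - l ^ m * Psi l c)
            (fun m => l ^ m / INR m) /\
    is_bigO (fun m => alpha_opt l m - (1 - c / INR m))
            (fun m => 1 / Rpower (INR m) (3 / 2)).
Proof.
  assert (Hl' : 0 < l < 1) by lra. clear Hl. rename Hl' into Hl.
  destruct (Psi_unique_minimizer l Hl) as [c Hc]. exists c. split; [exact Hc|].
  destruct Hc as [Hc _]. pose proof Hc as [Hc0 Hcmin].
  pose proof (rate_pos l Hl) as Hk.
  assert (Hp : 0 < (1 - l) * rate l) by (apply Rmult_lt_0_compat; lra).
  set (K := Psi l 0 / ((1 - l) * rate l)).
  assert (HK : K * ((1 - l) * rate l) = Psi l 0) by (unfold K; field; lra).
  assert (HK0 : 0 <= K).
  { apply Rdiv_le_0_compat; [|exact Hp]. pose proof (Psi_lower l 0 Hl). lra. }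
  (* The interval [[0, K + c]] contains both [c] and every rescaled minimizer [d <= K]. *)
  destruct (Fm_close_Psi l (K + c) Hl ltac:(lra)) as [C [HC Hclose]].
  set (mu := (1 - l) * rate l ^ 2).
  assert (Hmu : 0 < mu) by (apply Rmult_lt_0_compat; [lra|apply pow_lt; exact Hk]).
  assert (Key : forall m : nat, (2 <= m)%nat -> c <= INR m ->
    exists d, alpha_opt l m = 1 - d / INR m /\
      Rabs (Fm l m (d / INR m) - Psi l c) <= C / INR m /\
      (d - c) ^ 2 <= 8 * C / mu / INR m).
  { intros m Hm Hcm.
    assert (Hm2 : 2 <= INR m) by (apply (le_INR 2); exact Hm).
    destruct (alpha_opt_minimizer l m Hl Hm) as [[Ha0 Ha1] Hmin].
    exists (INR m * (1 - alpha_opt l m)).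
    set (a := alpha_opt l m) in *. set (d := INR m * (1 - a)).
    assert (Hd : d / INR m = 1 - a) by (unfold d; field; lra).
    assert (Hd0 : 0 <= d) by (apply Rmult_le_pos; lra).
    assert (HF : forall x, 0 <= x <= 1 -> Fm l m (d / INR m) <= Fm l m x).
    { intros x Hx. rewrite Hd. specialize (Hmin (1 - x) ltac:(lra)).
      replace a with (1 - (1 - a)) in Hmin by ring. rewrite !Rm_Fm in Hmin by exact Hl.
      apply Rmult_le_reg_l with (l ^ m); [apply pow_lt; lra|exact Hmin]. }
    (* Minimality gives [Fm l m (d / m) <= Fm l m 0 = Psi l 0], against the affine lower bound in
       [d]. *)
    assert (HdK : d <= K).
    { assert (H0 := HF 0 ltac:(lra)). rewrite Fm_0 in H0.
      assert (H1 := Fm_lower l m (d / INR m) Hl ltac:(apply Rdiv_le_0_compat; lra)).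
      replace (INR m * (d / INR m)) with d in H1 by (field; lra). nra. }
    assert (Hx : 0 <= c / INR m <= 1).
    { split; [apply Rdiv_le_0_compat; lra|]. apply Rmult_le_reg_r with (INR m); [lra|].
      unfold Rdiv. rewrite Rmult_assoc, Rinv_l; lra. }
    (* Two sandwiches: [Psi c - C/m <= Psi d - C/m <= Fm (d/m) <= Fm (c/m) <= Psi c + C/m]. Hence
       [Psi d - Psi c <= 2C/m], and growth with constant [mu / 4] yields the [8 * C / mu]. *)
    assert (Hdd := Hclose m d ltac:(lia) ltac:(lra)).
    assert (Hcc := Hclose m c ltac:(lia) ltac:(lra)).
    apply Rabs_le_between in Hdd. apply Rabs_le_between in Hcc.
    specialize (HF _ Hx). assert (Hpd := Hcmin d Hd0).
    split; [rewrite Hd; ring|]. split; [apply Rabs_le_between; lra|].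
    assert (Hg := strongly_convex_minimizer_growth _ _ _ _ d (Psi_strongly_convex l Hl) Hc Hd0).
    fold mu in Hg.
    apply Rmult_le_reg_l with mu; [exact Hmu|].
    replace (mu * (8 * C / mu / INR m)) with (8 * (C / INR m)) by (field; lra).
    lra. }
  assert (Hev : eventually (fun m => (2 <= m)%nat /\ c <= INR m)).
  { destruct (nfloor_ex c Hc0) as [n Hn]. exists (n + 2)%nat. intros m Hm.
    split; [lia|]. apply le_INR in Hm. rewrite plus_INR in Hm. simpl in Hm. lra. }
  split.
  - exists C. revert Hev. apply filter_imp.
    intros m [Hm Hcm]. assert (Hm2 : 2 <= INR m) by (apply (le_INR 2); exact Hm).
    destruct (Key m Hm Hcm) as [d [Ea [Hd _]]].
    assert (Hlm : 0 < l ^ m) by (apply pow_lt; lra).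
    rewrite Ea, Rm_Fm by exact Hl. rewrite <- Rmult_minus_distr_l, Rabs_mult.
    rewrite (Rabs_pos_eq (l ^ m)), (Rabs_pos_eq (l ^ m / INR m))
      by (try apply Rdiv_le_0_compat; lra).
    replace (C * (l ^ m / INR m)) with (l ^ m * (C / INR m)) by (field; lra).
    apply Rmult_le_compat_l; lra.
  - exists (sqrt (8 * C / mu)). revert Hev. apply filter_imp.
    intros m [Hm Hcm]. assert (Hm2 : 2 <= INR m) by (apply (le_INR 2); exact Hm).
    destruct (Key m Hm Hcm) as [d [Ea [_ Hd]]].
    (* Split [m^(3/2)] as [m * sqrt m]: one factor undoes the rescaling, the other comes from the
       bound on [(d - c) ^ 2]. *)
    replace (3 / 2) with (1 + / 2) by field.
    rewrite Rpower_plus, Rpower_1, Rpower_sqrt by lra.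
    assert (Hs : 0 < sqrt (INR m)) by (apply sqrt_lt_R0; lra).
    rewrite Ea. replace (1 - d / INR m - (1 - c / INR m)) with (- ((d - c) / INR m)) by (field; lra).
    rewrite Rabs_Ropp. unfold Rdiv at 1. rewrite Rabs_mult, (Rabs_pos_eq (/ INR m))
      by (left; apply Rinv_0_lt_compat; lra).
    rewrite (Rabs_pos_eq (1 / (INR m * sqrt (INR m))))
      by (apply Rdiv_le_0_compat; [lra|apply Rmult_lt_0_compat; lra]).
    replace (sqrt (8 * C / mu) * (1 / (INR m * sqrt (INR m))))
      with (sqrt (8 * C / mu) / sqrt (INR m) * / INR m) by (field; lra).
    apply Rmult_le_compat_r; [left; apply Rinv_0_lt_compat; lra|].
    rewrite <- sqrt_div by (try lra; apply Rdiv_le_0_compat; lra).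
    rewrite <- (sqrt_Rsqr_abs (d - c)). apply sqrt_le_1_alt. rewrite Rsqr_pow2. exact Hd.
Qed.
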